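(* Let $d\ge1$ and let $$X_\infty:=\bigcup_{i\ge 0}\ \sum_{j=0}^{i}2^j\{e_1,-e_1,\dots,e_d,-e_d\}\subset\mathbb{Z}^d .$$ Then the characteristic function of $X_\infty$, viewed as a $\mathbb{Z}_2$-valued function, is harmonic on $\mathbb{Z}^d$, but $X_\infty$ does not satisfy the cross condition. However, the set $$X_+:=X_\infty+\{0,e_1,-e_1,\dots,e_d,-e_d\}$$ satisfies the cross condition and has the same discrete dimension as $X_\infty$.
   Context: $e_1,\dots,e_d$ are the standard basis vectors of $\mathbb{Z}^d$; sums of sets are Minkowski sums and $2^jA=\{2^ja:a\in A\}$. A function $u:\mathbb{Z}^d\to\mathbb{Z}_2=\mathbb{Z}/2\mathbb{Z}$ is harmonic if $\sum_{i=1}^d\big(u(x+e_i)+u(x-e_i)\big)=0$ in $\mathbb{Z}_2$ for all $x\in\mathbb{Z}^d$. A set $X\subset\mathbb{Z}^d$ satisfies the cross condition if there is no $y\in\mathbb{Z}^d$ such that $X$ intersects the cross $\{y\}\cup\bigcup_{i=1}^d\{y-e_i,y+e_i\}$ in exactly one point. The discrete dimension of $X$ is $\limsup_{r\to\infty}\frac{\ln|X\cap B_r(0)|}{\ln r}$, where $B_r(0)$ is the ball of radius $r$ centered at $0$ (the choice of norm does not matter). *)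

(* Defs.v *)
From HB Require Import structures.
From mathcomp Require Import all_boot all_order all_algebra.
From mathcomp Require Import finmap.
From mathcomp Require Import all_classical all_reals all_analysis.
Import Order.TTheory GRing.Theory Num.Theory.
Import numFieldNormedType.Exports.
Local Open Scope classical_set_scope.
Local Open Scope ring_scope.

Definition lattice_basis {d : nat} (i : 'I_d) : 'rV[int]_d := delta_mx 0 i.

Definition unit_vectors (d : nat) : set 'rV[int]_d :=
  [set x | exists i : 'I_d, x = lattice_basis i \/ x = - lattice_basis i].

Definition minkowski_sum {d : nat} (A B : set 'rV[int]_d) : set 'rV[int]_d :=
  [set a + b | a in A & b in B].

Definition dilate {d : nat} (c : int) (A : set 'rV[int]_d) : set 'rV[int]_d :=
  [set c *: a | a in A].

Definition harmonic_mod2 {d : nat} (u : 'rV[int]_d -> 'Z_2) : Prop :=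
  forall x : 'rV[int]_d,
    \sum_(i < d) (u (x + lattice_basis i) + u (x - lattice_basis i)) = 0.

Definition cross {d : nat} (y : 'rV[int]_d) : set 'rV[int]_d :=
  y |` \bigcup_(i in [set: 'I_d]) [set y - lattice_basis i; y + lattice_basis i].

Definition cross_condition {d : nat} (X : set 'rV[int]_d) : Prop :=
  ~ exists y : 'rV[int]_d, exists x : 'rV[int]_d, X `&` cross y = [set x].

(* [ball] on ['rV[R]_d] is the open ball of the sup norm; the dimension below does
   not depend on the choice of norm. *)
Definition lattice_ball (R : realType) (d : nat) (r : R) : set 'rV[int]_d :=
  [set x | ball (0 : 'rV[R]_d) r (map_mx intr x)].

(* [fset_set] is the finite set underlying a finite classical set; lattice
   balls are finite, so its cardinality is the genuine one.  [lne 0] is -oo. *)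
Definition discrete_dimension (R : realType) {d : nat} (X : set 'rV[int]_d) :
    \bar R :=
  limf_esup
    (fun r : R =>
       (lne ((#|` fset_set (X `&` lattice_ball R d r)|)%:R%:E) / (ln r)%:E)%E)
    (pinfty_nbhs R).

Definition X_infty (d : nat) : set 'rV[int]_d :=
  \bigcup_(i in [set: nat])
    \big[minkowski_sum/[set 0]]_(0 <= j < i.+1)
      dilate (2 ^+ j) (unit_vectors d).

Definition X_plus (d : nat) : set 'rV[int]_d :=
  minkowski_sum (X_infty d) (0 |` unit_vectors d).

(* Main.v *)
Require Import Defs.
From HB Require Import structures.
From mathcomp Require Import all_boot all_order all_algebra.
From mathcomp Require Import finmap.
From mathcomp Require Import all_classical all_reals all_analysis.
From mathcomp Require Import zify lra.
Import Order.TTheory GRing.Theory Num.Theory.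
Import numFieldNormedType.Exports.
Local Open Scope classical_set_scope.
Local Open Scope ring_scope.

(** Write [U] for the set of the [2 d] vectors [e_i] and [- e_i].  Everything
    rests on the self-similarity [X_infty = U + 2 X_infty] ([X_inftyP]) together
    with the uniqueness of the first digit ([X_infty_digit_unique]): modulo 2 the
    digit gives away its axis, and its sign is then fixed by the parity of the
    coordinate sum, which is odd on the whole of [X_infty].

    Harmonicity.  Let [L f x] be the sum of [f] over the neighbours of [x], let
    [u] be the indicator of [X_infty] and [v] that of [2 X_infty].  Unique digits
    say [u = L v], so [L u = L (L v)].  In characteristic 2 the symmetric double
    sum [L (L v)] collapses to its diagonal, the sum of the [v (x + 2 s)] for
    [s] in [U]; this is the identity that the square of the Laurent polynomial
    [P = sum of x_i + 1 / x_i] is [P] evaluated at squares.  The diagonal vanishes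
    unless [x = 2 w], and then it is [L u w].  Halving repeatedly leads to [x = 0],
    where the sum counts the [2 d] elements of [U], all in [X_infty].

    Cross conditions.  Neighbours have opposite parity, so a point of [X_infty] is
    isolated in its own cross.  For [X_plus], a centre [y] in [X_plus] has a
    neighbour in [X_plus].  Otherwise a point [z] of [X_plus] in the cross is not
    in [X_infty], as [y] would then be in [X_plus].  So [z] is adjacent to some
    point of [X_infty], hence by harmonicity to two of them, [z + s] and [z + t].  If [z = y + p], one of [s] and [t], say [t], is not [p];
    then [y + t] is another point of the cross, adjacent to [z + t].

    Dimension.  A point of [X_plus] has the form [s + 2 y - s'] with [y] in
    [X_infty], [s] in [U] and [s'] in [U] or zero.  If it lies in a ball of radius
    [r >= 2], so does [y], since the halving absorbs the perturbation.  Hence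
    [X_plus] has at most [2 d (2 d + 1)] times as many points in the ball as
    [X_infty], and a bounded factor disappears after dividing logarithms by
    [ln r]. *)

(** * Signed unit vectors *)

(** Indexing the unit vectors by a finite type lets sums over the neighbours of a
    point be ordinary finite sums; the boolean is true for the minus sign. *)
Definition signed_unit {d : nat} (p : 'I_d * bool) : 'rV[int]_d :=
  if p.2 then - lattice_basis p.1 else lattice_basis p.1.

Definition opposite {d : nat} (p : 'I_d * bool) : 'I_d * bool := (p.1, ~~ p.2).

Lemma signed_unit_opposite (d : nat) (p : 'I_d * bool) :
  signed_unit (opposite p) = - signed_unit p.
Proof. by case: p => i []; rewrite /signed_unit /= ?opprK. Qed.

Lemma unit_vectorsP (d : nat) (x : 'rV[int]_d) :
  unit_vectors d x <-> exists p, x = signed_unit p.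
Proof.
split=> [[i [->|->]]|[[i b] ->]].
- by exists (i, false).
- by exists (i, true).
- by exists i; case: b; [right|left].
Qed.

Lemma signed_unit_entry (d : nat) (p : 'I_d * bool) (i : 'I_d) :
  signed_unit p 0 i = (-1) ^+ p.2 * (i == p.1)%:R.
Proof.
rewrite /signed_unit /lattice_basis; case: p => j [] /=;
by rewrite !mxE /= ?mulN1r ?mul1r.
Qed.

Lemma sum_signed_unit (d : nat) (V : nmodType) (f : 'rV[int]_d -> V)
    (x : 'rV[int]_d) :
  \sum_(i < d) (f (x + lattice_basis i) + f (x - lattice_basis i)) =
  \sum_(p : 'I_d * bool) f (x + signed_unit p).
Proof.
rewrite -(pair_bigA _ (fun i b => f (x + signed_unit (i, b)))) /=.
by apply: eq_bigr => i _; rewrite big_bool /= addrC.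
Qed.

Lemma crossP (d : nat) (x y : 'rV[int]_d) :
  cross y x <-> x = y \/ exists p, x = y + signed_unit p.
Proof.
split=> [[->|[i _ [->|->]]]|[->|[[i []] ->]]].
- by left.
- by right; exists (i, true).
- by right; exists (i, false).
- by left.
- by right; exists i => //; left.
- by right; exists i => //; right.
Qed.

(** * Parity *)
Lemma int_Z2_double (a : int) : (2 * a)%:~R = 0 :> 'Z_2.
Proof. by rewrite intrM (_ : 2%:~R = 0 :> 'Z_2) ?mul0r //; apply/val_inj. Qed.

Lemma addZ2_self (a : 'Z_2) : a + a = 0.
Proof.
by rewrite -mulr2n -mulr_natl (_ : 2 = 0 :> 'Z_2) ?mul0r //; apply/val_inj.
Qed.

Lemma signed_unit_entry_mod2 (d : nat) (p : 'I_d * bool) (i : 'I_d) :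
  (signed_unit p 0 i)%:~R = (i == p.1)%:R :> 'Z_2.
Proof.
rewrite signed_unit_entry; case: p => j []; case: eqP => //= _;
by rewrite ?mulr0 ?expr1 ?expr0 ?mulr1 //; apply/val_inj.
Qed.

Definition parity {d : nat} (x : 'rV[int]_d) : 'Z_2 := \sum_(k < d) (x 0 k)%:~R.

Lemma parityD (d : nat) (x y : 'rV[int]_d) : parity (x + y) = parity x + parity y.
Proof. by rewrite -big_split; apply: eq_bigr => k _; rewrite mxE intrD. Qed.

Lemma parity_double (d : nat) (x : 'rV[int]_d) : parity (2 *: x) = 0.
Proof. by rewrite /parity big1 // => k _; rewrite mxE int_Z2_double. Qed.

Lemma parity_signed_unit (d : nat) (p : 'I_d * bool) : parity (signed_unit p) = 1.
Proof.
rewrite /parity (eq_bigr _ (fun k _ => signed_unit_entry_mod2 d p k)).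
by rewrite (bigD1 p.1) //= eqxx big1 ?addr0 // => k /negbTE ->.
Qed.

Lemma dilateD (d : nat) (c : int) (A B : set 'rV[int]_d) :
  dilate c (minkowski_sum A B) = minkowski_sum (dilate c A) (dilate c B).
Proof.
apply/seteqP; split=> [_ [_ [a Aa [b Bb <-]] <-]|_ [_ [a Aa <-] [_ [b Bb <-] <-]]].
  by exists (c *: a); [exists a | exists (c *: b); [exists b | rewrite scalerDr]].
by exists (a + b); [exists a => //; exists b | rewrite scalerDr].
Qed.

(** * Self-similarity of X_infty *)

(** The sum of the first [n] digit sets; [n = 0] is allowed so that the recursion
    [levelS] starts from the singleton of the origin. *)
Definition level (d n : nat) : set 'rV[int]_d :=
  \big[minkowski_sum/[set 0]]_(0 <= j < n) dilate (2 ^+ j) (unit_vectors d).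

(** Peeling off the digit of weight 1, rather than the top one, exposes the
    self-similarity: the remaining digits all carry a factor 2. *)
Lemma levelS (d n : nat) :
  level d n.+1 = minkowski_sum (unit_vectors d) (dilate 2 (level d n)).
Proof.
rewrite /level big_nat_recl //; congr minkowski_sum.
  rewrite expr0; apply/seteqP; split=> [_ [x ux <-]|x ux]; rewrite ?scale1r //.
  by exists x; rewrite ?scale1r.
elim/big_ind2 : _ => [|A A' B B' -> ->|j _].
- apply/seteqP; split=> [x ->|_ [x -> <-]]; last by rewrite scaler0.
  by exists 0; rewrite ?scaler0.
- by rewrite dilateD.
- rewrite exprS; apply/seteqP; split=> [_ [x ux <-]|_ [_ [x ux <-] <-]].
    by exists (2 ^+ j *: x); [exists x | rewrite scalerA].
  by exists x; rewrite ?scalerA.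
Qed.

Lemma signed_unit_X_infty (d : nat) (p : 'I_d * bool) :
  X_infty d (signed_unit p).
Proof.
exists 0%N => //; rewrite -/(level d 1) levelS /level big_nil.
exists (signed_unit p); first by apply/unit_vectorsP; exists p.
by exists 0; [exists 0; rewrite ?scaler0 | rewrite addr0].
Qed.

(** The union starts at one digit, so the origin is missing; a single digit must
    therefore be rewritten with two before it can be peeled. *)
Lemma X_inftyP (d : nat) (x : 'rV[int]_d) :
  X_infty d x <->
  exists p y, X_infty d y /\ x = signed_unit p + 2 *: y.
Proof.
split=> [[n _]|[p [y [[n _ ny] ->]]]]; last first.
  exists n.+1 => //; rewrite -/(level d n.+2) levelS.
  exists (signed_unit p); first by apply/unit_vectorsP; exists p.
  by exists (2 *: y) => //; exists y.
rewrite -/(level d n.+1) levelS => -[_ /unit_vectorsP[p ->]] [_ [y ny <-] <-].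
case: n ny => [|n] ny; last by exists p, y; split=> //; exists n.
move: ny; rewrite /level big_nil => ->.
(* The length-one representation e lengthens to -e + 2 e. *)
exists (opposite p), (signed_unit p); split; first exact: signed_unit_X_infty.
by rewrite signed_unit_opposite scaler0 addr0 scaler_nat mulr2n addKr.
Qed.

Lemma parity_X_infty (d : nat) (x : 'rV[int]_d) : X_infty d x -> parity x = 1.
Proof.
move=> /X_inftyP[p [y [_ ->]]].
by rewrite parityD parity_double addr0 parity_signed_unit.
Qed.

(** Modulo 2, both sides show the axis of their digit.  Opposite digits [p] and
    [q] on the same axis would give [y = q + z], putting two points of [X_infty]
    at odd distance. *)
Lemma X_infty_digit_unique (d : nat) (p q : 'I_d * bool) (y z : 'rV[int]_d) :
  X_infty d y -> X_infty d z ->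
  signed_unit p + 2 *: y = signed_unit q + 2 *: z -> p = q.
Proof.
move=> Xy Xz E.
have Ei : p.1 = q.1.
  have /eqP := congr1 (fun x : 'rV[int]_d => (x 0 p.1)%:~R : 'Z_2) E.
  rewrite !mxE !intrD !int_Z2_double !addr0 !signed_unit_entry_mod2 eqxx.
  by case: (p.1 =P q.1).
case: (eqVneq p.2 q.2) => [Eb|Nb].
  by case: p q Ei Eb {E} => ? ? [? ?] /= -> ->.
have Eo : p = opposite q.
  by case: p q Ei Nb {E} => i [] [j []] //= -> _.
have Ey : y = signed_unit q + z.
  apply/rowP => i; move: (congr1 (fun x : 'rV[int]_d => x 0 i) E).
  rewrite Eo signed_unit_opposite !mxE.
  by move: (y 0 i) (z 0 i) (signed_unit q 0 i) => a b c; lia.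
have := parity_X_infty d y Xy.
by rewrite Ey parityD parity_signed_unit (parity_X_infty d z Xz).
Qed.

(** * Harmonicity *)

(** Off-diagonal terms come in equal pairs. *)
Lemma sum_symmetric_char2 (V : nmodType) (I : Type) (r : seq I)
    (F : I -> I -> V) :
  (forall a : V, a + a = 0) -> (forall p q, F p q = F q p) ->
  \sum_(p <- r) \sum_(q <- r) F p q = \sum_(p <- r) F p p.
Proof.
move=> char2 symF; elim: r => [|a r IHr]; first by rewrite !big_nil.
rewrite !big_cons -IHr.
under [X in _ + X = _]eq_bigr do rewrite big_cons.
rewrite big_split /= (eq_bigr _ (fun q _ => symF q a)).
by rewrite -addrA (addrA (\sum_(q <- r) F a q)) char2 add0r.
Qed.

(** By uniqueness of the first digit, at most one term of the sum is non-zero. *)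
Lemma X_infty_laplacian (d : nat) (x : 'rV[int]_d) :
  \1_(X_infty d) x =
  \sum_(p : 'I_d * bool) \1_(dilate 2 (X_infty d)) (x + signed_unit p) :> 'Z_2.
Proof.
rewrite indicE; case: (boolP (x \in X_infty d)) => [|/negP xN].
  rewrite inE => /X_inftyP[p [y [Xy ->]]].
  rewrite (bigD1 (opposite p)) //= indicE mem_set ?big1 ?addr0 //; last first.
    by rewrite signed_unit_opposite addrAC subrr add0r; exists y.
  move=> q /eqP Nq; rewrite indicE memNset // => -[z Xz Ez]; apply: Nq.
  suff -> : p = opposite q by case: (q) => i b; rewrite /opposite negbK.
  apply: (X_infty_digit_unique d _ _ y z) => //.
  by rewrite Ez signed_unit_opposite [RHS]addrC addrK.
rewrite big1 // => p _; rewrite indicE memNset // => -[y Xy Ey]; apply: xN.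
rewrite inE; apply/X_inftyP; exists (opposite p), y; split => //.
by rewrite signed_unit_opposite Ey addrC addrK.
Qed.

(** Applying the Laplacian twice amounts, modulo 2, to applying it once with step
    2; this turns a question about [x] into one about [x / 2]. *)
Lemma laplacian_X_infty_double (d : nat) (x : 'rV[int]_d) :
  \sum_(p : 'I_d * bool) \1_(X_infty d) (x + signed_unit p) =
  \sum_(p : 'I_d * bool)
    \1_(dilate 2 (X_infty d)) (x + 2 *: signed_unit p) :> 'Z_2.
Proof.
under eq_bigr do rewrite X_infty_laplacian.
rewrite (sum_symmetric_char2 _ _ _ (fun p q : 'I_d * bool =>
  \1_(dilate 2 (X_infty d)) (x + signed_unit p + signed_unit q))).
- by apply: eq_bigr => p _; rewrite scaler_nat mulr2n addrA.
- exact: addZ2_self.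
- by move=> p q; rewrite addrAC.
Qed.

Lemma scale2_inj (d : nat) : injective (fun x : 'rV[int]_d => 2 *: x).
Proof.
move=> x y /rowP E; apply/rowP => i; move: (E i); rewrite !mxE.
by move: (x 0 i) (y 0 i) => a b; lia.
Qed.

Lemma harmonic_X_infty (d : nat) :
  harmonic_mod2 (\1_(X_infty d) : 'rV[int]_d -> 'Z_2).
Proof.
move=> x; rewrite sum_signed_unit.
suff H n : forall z : 'rV[int]_d, (forall i, `|z 0 i| <= n%:Z) ->
    \sum_(p : 'I_d * bool) \1_(X_infty d) (z + signed_unit p) = 0 :> 'Z_2.
  apply: (H (\sum_(i < d) absz (x 0%R i))%N) => i.
  by rewrite (bigD1 i) //= -abszE lez_nat leq_addr.
(* Halving strictly decreases the bound on the coordinates until it is 0. *)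
elim/ltn_ind: n => n IHn z zn.
rewrite laplacian_X_infty_double.
have [[w Ew]|zN] := pselect (exists w : 'rV[int]_d, z = 2 *: w); last first.
  rewrite big1 // => p _; rewrite indicE memNset // => -[y _ Ey]; apply: zN.
  by exists (y - signed_unit p); rewrite scalerBr Ey addrK.
rewrite Ew; under eq_bigr => p _.
  rewrite (_ : \1_(dilate 2 (X_infty d)) _ =
               \1_(X_infty d) (w + signed_unit p)); last first.
    rewrite !indicE; congr (nat_of_bool _)%:R; apply/idP/idP; rewrite !inE.
      by case=> y Xy; rewrite -scalerDr => /scale2_inj <-.
    by exists (w + signed_unit p); rewrite ?scalerDr.
  over.
case: (posnP n) => [n0|n_gt0]; last first.
  apply: (IHn n.-1) => [|i]; first by rewrite prednK.
  move: (zn i); rewrite Ew mxE; move: (w 0 i) => a; lia.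
have -> : w = 0.
  by apply/rowP => i; move: (zn i); rewrite Ew n0 !mxE; move: (w 0 i) => a; lia.
rewrite (eq_bigr (fun=> 1)) => [|p _]; last first.
  by rewrite add0r indicE mem_set //; exact: signed_unit_X_infty.
rewrite -(pair_bigA _ (fun _ _ => 1)) big1 // => i _ /=.
by rewrite big_bool; exact: addZ2_self.
Qed.

(** * Cross conditions *)

(** The centre of the offending cross can be any point of [X_infty]: its neighbours
    have the wrong parity to belong to [X_infty]. *)
Lemma not_cross_condition_X_infty (d : nat) :
  (1 <= d)%N -> ~ cross_condition (X_infty d).
Proof.
move=> d_gt0; apply; exists (signed_unit (Ordinal d_gt0, false)).
exists (signed_unit (Ordinal d_gt0, false)); apply/seteqP; split=> [x|_ ->].
  move=> [Xx /crossP[->//|[p Ex]]].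
  by have := parity_X_infty d x Xx; rewrite Ex parityD !parity_signed_unit.
by split; [exact: signed_unit_X_infty | apply/crossP; left].
Qed.

Lemma X_plusP (d : nat) (x : 'rV[int]_d) :
  X_plus d x <-> X_infty d x \/ exists p, X_infty d (x + signed_unit p).
Proof.
split=> [[a Xa [_ [->|/unit_vectorsP[p ->]] <-]]|[Xx|[p Xp]]].
- by rewrite addr0; left.
- by right; exists (opposite p); rewrite signed_unit_opposite addrK.
- by exists x => //; exists 0; [left | rewrite addr0].
- exists (x + signed_unit p) => //; exists (signed_unit (opposite p)).
    by right; apply/unit_vectorsP; exists (opposite p).
  by rewrite signed_unit_opposite addrK.
Qed.

(** A sum of zeros and exactly one 1 cannot vanish modulo 2. *)
Lemma harmonic_second_neighbour (d : nat) (x : 'rV[int]_d) (p : 'I_d * bool) :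
  X_infty d (x + signed_unit p) ->
  exists2 q, q != p & X_infty d (x + signed_unit q).
Proof.
move=> Xp; have := harmonic_X_infty d x; rewrite sum_signed_unit => H0.
have [[q qp Xq]|N] :=
  pselect (exists2 q, q != p & X_infty d (x + signed_unit q)).
  by exists q.
move: H0; rewrite (bigD1 p) //= indicE mem_set // big1 => [|q qp].
  by move/eqP.
by rewrite indicE memNset // => Xq; apply: N; exists q.
Qed.

Lemma signed_unit_inj (d : nat) : injective (@signed_unit d).
Proof.
move=> p q E; apply: (X_infty_digit_unique d p q (signed_unit p) (signed_unit p));
  rewrite ?E //; exact: signed_unit_X_infty.
Qed.

Lemma signed_unit_neq0 (d : nat) (p : 'I_d * bool) : signed_unit p <> 0.
Proof.
move=> E; have := parity_signed_unit d p; rewrite E /parity big1 // => k _.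
by rewrite mxE.
Qed.

(** Harmonicity of [X_infty] at the presumed unique point of the cross yields a
    second point. *)
Lemma cross_condition_X_plus (d : nat) : cross_condition (X_plus d).
Proof.
move=> [y [x E]].
have single u v : X_plus d u -> cross y u -> X_plus d v -> cross y v -> u = v.
  move=> Xu cu Xv cv; have -> : u = x by have : [set x] u by rewrite -E.
  by have -> : v = x by have : [set x] v by rewrite -E.
have nbr p : cross y (y + signed_unit p) by apply/crossP; right; exists p.
have self : cross y y by apply/crossP; left.
have yN : ~ X_plus d y.
  move=> Xy; suff [p Xp] : exists p, X_plus d (y + signed_unit p).
    apply: (signed_unit_neq0 d p); apply: (addrI y).
    by rewrite addr0; exact: single.
  case/X_plusP: (Xy) => [Iy|[p Xp]]; last by exists p; apply/X_plusP; left.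
  have /X_inftyP[p _] := Iy; exists p; apply/X_plusP; right; exists (opposite p).
  by rewrite signed_unit_opposite addrK.
have [Xx cx] : (X_plus d `&` cross y) x by rewrite E.
case/crossP: cx => [Exy|[p Exp]]; first by rewrite Exy in Xx.
rewrite {}Exp in Xx E; case/X_plusP: (Xx) => [Ip|[q Iq]].
  by apply: yN; apply/X_plusP; right; exists p.
(* Of the two directions towards X_infty, at least one differs from p; it can
   be followed from y as well. *)
have [t tp It] : exists2 t,
    t != p & X_infty d (y + signed_unit p + signed_unit t).
  have [r rq Ir] := harmonic_second_neighbour d _ q Iq.
  by case: (eqVneq q p) => [qp|]; [exists r; rewrite // -qp | exists q].
move/eqP: tp; apply; apply: signed_unit_inj; apply: (addrI y).
apply: single => //; apply/X_plusP; right; exists p.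
by rewrite addrAC.
Qed.

(** * Discrete dimension *)
Lemma lattice_ballP (R : realType) (d : nat) (r : R) (x : 'rV[int]_d) :
  lattice_ball R d r x <-> 0 < r /\ forall i, `|(x 0 i)%:~R| < r.
Proof.
rewrite /lattice_ball; split=> [[r0 xr]|[r0 xr]].
  by split=> // i; move: (xr 0 i); rewrite -ball_normE /= !mxE sub0r normrN.
by split=> // i j; rewrite -ball_normE /= !mxE sub0r normrN (ord1 i).
Qed.

Lemma finite_lattice_ball (R : realType) (d : nat) (r : R) :
  finite_set (lattice_ball R d r).
Proof.
have [n rn] : exists n : nat, r < n%:R.
  exists (Num.bound `|r|).
  exact: le_lt_trans (ler_norm r) (archi_boundP (normr_ge0 r)).
(* The ball is covered by a cube of side 2 n, enumerated after a shift by n. *)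
pose f (u : 'rV['I_(n + n).+1]_d) : 'rV[int]_d :=
  map_mx (fun k : 'I_(n + n).+1 => k%:Z - n%:Z) u.
apply: (@sub_finite_set _ _ [set f u | u in setT]); last first.
  by apply: finite_image; exact: finite_finset.
move=> x /lattice_ballP[_ xr].
have xn i : `|x 0 i| < n%:Z.
  by rewrite -(ltr_int R) intr_norm; exact: lt_trans (xr i) rn.
exists (\row_i inord (absz (x 0 i + n%:Z))) => //.
apply/rowP => i; rewrite !mxE; move: (xn i) => {}xn.
rewrite inordK; move: (x 0 i) xn => a; lia.
Qed.

Lemma limf_esup_le_eps (T : choiceType) (X : filteredType T) (R : realType)
    (f g : X -> \bar R) (F : set_system X) :
  Filter F ->
  (forall e : R, 0 < e -> \forall r \near F, (f r <= g r + e%:E)%E) ->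
  (limf_esup f F <= limf_esup g F)%E.
Proof.
move=> FF fg; apply/lee_addgt0Pr => e e_gt0; rewrite !limf_esupE.
rewrite -leeBlDr //; apply: le_ereal_inf_tmp => _ [V FV <-]; rewrite leeBlDr //.
apply: ge_ereal_inf.
exists (ereal_sup (f @` (V `&` [set r | (f r <= g r + e%:E)%E]))).
  exists (V `&` [set r | (f r <= g r + e%:E)%E]) => //.
  exact: filterI (fg e e_gt0).
apply: ge_ereal_sup => _ [r [Vr /= fgr] <-]; apply: (le_trans fgr).
by rewrite leeD2r //; apply: ereal_sup_ubound; exists r.
Qed.

(** The factor [K] only adds [ln K / ln r], which tends to 0. *)
Lemma discrete_dimension_le (R : realType) (d K : nat) (A B : set 'rV[int]_d) :
  (\forall r \near pinfty_nbhs R,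
    (#|` fset_set (A `&` lattice_ball R d r)| <=
     K * #|` fset_set (B `&` lattice_ball R d r)|)%N) ->
  (discrete_dimension R A <= discrete_dimension R B)%E.
Proof.
move=> AB; apply: limf_esup_le_eps => e e_gt0; near=> r.
have : (#|` fset_set (A `&` lattice_ball R d r)| <=
     K * #|` fset_set (B `&` lattice_ball R d r)|)%N by near: r.
move: (#|` fset_set (A `&` _)|) (#|` fset_set (B `&` _)|) => a b aKb.
have lnr_gt0 : 0 < ln r by apply: ln_gt0; near: r; exact: nbhs_pinfty_gt.
have invE : (((ln r)%:E)^-1 = ((ln r)^-1)%:E)%E by rewrite inver gt_eqF.
(* If A misses the ball, its logarithm is -oo and nothing is left to compare. *)
have [->|a_gt0] := posnP a.
  rewrite le0_lneNy ?lee_fin ?mulr0n // invE mulNyr gtr0_sg ?invr_gt0 //.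
  by rewrite mul1e leNye.
have [K_gt0 b_gt0] : (0 < K)%N /\ (0 < b)%N.
  by apply/andP; rewrite -muln_gt0; exact: leq_trans a_gt0 aKb.
have r_big : ln K%:R / e < ln r.
  rewrite -ltr_expR lnK ?posrE; last by near: r; exact: nbhs_pinfty_gt.
  by near: r; exact: nbhs_pinfty_gt.
rewrite !lne_EFin ?ltr0n // invE -!EFinM -EFinD lee_fin.
rewrite ler_pdivrMr // mulrDl divfK ?gt_eqF //.
have : ln (a%:R : R) <= ln (K%:R : R) + ln (b%:R : R).
  rewrite -lnM ?posrE ?ltr0n // ler_ln ?posrE ?mulr_gt0 ?ltr0n //.
  by rewrite -natrM ler_nat.
move: r_big; rewrite ltr_pdivrMr // => H1 H2; lra.
Unshelve. all: by end_near.
Qed.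

Lemma card_fset_set_le (S T : choiceType) (A : set S) (B : set T) (I : finType)
    (h : I -> T -> S) :
  finite_set A -> finite_set B ->
  (forall x, A x -> exists i y, B y /\ x = h i y) ->
  (#|` fset_set A| <= #|I| * #|` fset_set B|)%N.
Proof.
move=> fA fB AB; rewrite cardE -(size_allpairs h).
apply: uniq_leq_size; first exact: fset_uniq.
move=> x; rewrite in_fset_set // inE => /AB[i [y [By ->]]].
by apply: allpairs_f; rewrite ?mem_enum // in_fset_set // inE.
Qed.

Lemma discrete_dimension_subset (R : realType) (d : nat) (A B : set 'rV[int]_d) :
  A `<=` B -> (discrete_dimension R A <= discrete_dimension R B)%E.
Proof.
move=> AB; apply: (@discrete_dimension_le R d #|{: unit}|); near=> r.
have fin (C : set 'rV[int]_d) : finite_set (C `&` lattice_ball R d r).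
  by apply: sub_finite_set (finite_lattice_ball R d r) => x [].
apply: (card_fset_set_le _ _ _ _ unit (fun _ => id)) => // x [Ax rx].
by exists tt, x; split => //; split => //; exact: AB.
Unshelve. all: by end_near.
Qed.

(** A point of [X_plus] is encoded by a shift into [X_infty], the first digit of
    the shifted point, and the point [y] of [X_infty] left after that digit.  The
    first two take boundedly many values. *)
Lemma discrete_dimension_X_plus_le (R : realType) (d : nat) :
  (discrete_dimension R (X_plus d) <= discrete_dimension R (X_infty d))%E.
Proof.
pose shift (s : option ('I_d * bool)) : 'rV[int]_d := oapp signed_unit 0 s.
pose I : finType := (option ('I_d * bool) * ('I_d * bool))%type.
pose h (i : I) (y : 'rV[int]_d) := signed_unit i.2 + 2 *: y - shift i.1.
apply: (@discrete_dimension_le R d #|I|); near=> r.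
have fin (C : set 'rV[int]_d) : finite_set (C `&` lattice_ball R d r).
  by apply: sub_finite_set (finite_lattice_ball R d r) => x [].
apply: (card_fset_set_le _ _ _ _ I h) => // x [Xx /lattice_ballP[r_gt0 xr]].
have [s Xs] : exists s, X_infty d (x + shift s).
  case/X_plusP: Xx => [Xx|[q Xq]]; first by exists None; rewrite addr0.
  by exists (Some q).
have /X_inftyP[p [y [Xy Exy]]] := Xs.
exists (s, p), y; rewrite /h -Exy addrK; split => //; split => //.
have r_ge2 : 2 <= r by near: r; exact: nbhs_pinfty_ge.
apply/lattice_ballP; split => // i.
have unit_le1 q : `|signed_unit q 0 i| <= 1.
  by rewrite signed_unit_entry normrM normrX normrN1 expr1n mul1r; case: (_ == _).
have shift_le1 : `|shift s 0 i| <= 1.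
  by case: (s) => [q|] /=; rewrite ?unit_le1 // mxE.
(* Doubling y costs at most the shift and the digit, hence the 2; so y stays
   in the ball as soon as r + 2 <= 2 * r. *)
have H : 2 * `|y 0 i| <= `|x 0 i| + 2.
  have := congr1 (fun z : 'rV[int]_d => z 0 i) Exy; rewrite !mxE.
  move: (unit_le1 p) shift_le1.
  move: (y 0 i) (x 0 i) (signed_unit p 0 i) (shift s 0 i) => a b u v; lia.
move: H (xr i); rewrite -(ler_int R) intrD intrM !intr_norm; lra.
Unshelve. all: by end_near.
Qed.

Theorem proposition2p8 (R : realType) (d : nat) (hd : (1 <= d)%N) :
  harmonic_mod2 (\1_(X_infty d) : 'rV[int]_d -> 'Z_2) /\
  ~ cross_condition (X_infty d) /\
  cross_condition (X_plus d) /\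
  discrete_dimension R (X_plus d) = discrete_dimension R (X_infty d).
Proof.
split; first exact: harmonic_X_infty.
split; first exact: not_cross_condition_X_infty.
split; first exact: cross_condition_X_plus.
apply/le_anti/andP; split; first exact: discrete_dimension_X_plus_le.
by apply: discrete_dimension_subset => x Xx; apply/X_plusP; left.
Qed.
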